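(* Let $q$ be the largest prime power dividing $k$. Then $$\mathfrak{s}\left((\mathbb{Z}/k\mathbb{Z})^n\right)\leq \left(J(q)\,q+o(1)\right)^n,$$ and the $o(1)$ term tends to $0$ as $n\to\infty$.
   Context: Here $k$ is a positive integer and $\mathbb{Z}/k\mathbb{Z}$ is the cyclic group of order $k$. For a finite abelian group $G$, $\exp(G)$ denotes its exponent (the maximal order of an element of $G$). The Erd\H{o}s-Ginzburg-Ziv constant $\mathfrak{s}(G)$ is the smallest $m\in\mathbb{N}$ such that any sequence of $m$ elements of $G$ (repetitions allowed) contains a subsequence of length $\exp(G)$ whose sum is $0$. The quantity $J(q)$ is defined by $$J(q)=\frac{1}{q}\min_{0<x<1}\frac{1-x^{q}}{1-x}\,x^{-\frac{q-1}{3}} .$$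
   Formalization: The case k = 2 is excluded, because the claim fails there: s((Z/2Z)^n) = 2^n + 1 for n ≥ 1, while J(2)·2 = (3/2)·2^{1/3} ≈ 1.89 < 2; all other positive k are covered, with q = 1 when k = 1. *)

(* Defs.v *)
From mathcomp Require Import all_boot all_order all_algebra all_fingroup all_solvable.

Set Implicit Arguments.
Unset Strict Implicit.
Unset Printing Implicit Defensive.

Import Order.TTheory GRing.Theory Num.Theory.
Local Open Scope ring_scope.

(* For a finZmodType, [#[x]%g] is the additive order of x. *)
Definition group_exp (G : finZmodType) : nat := \max_(x : G) #[x]%g.

Lemma group_expE (G : finZmodType) : group_exp G = exponent [set: G].
Proof.
apply/eqP; rewrite eqn_leq; apply/andP; split.
  apply/bigmax_leqP => x _; apply: dvdn_leq; first exact: exponent_gt0.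
  by apply: dvdn_exponent; rewrite in_setT.
have [x _ ->] := exponent_witness (abelian_nil (FinRing.zmod_abelian [set: G])).
exact: leq_bigmax.
Qed.

Definition EGZ_length (G : finZmodType) (m : nat) : bool :=
  [forall s : m.-tuple G, [exists t : (group_exp G).-tuple G,
     subseq t s && (\sum_(x <- t) x == 0)]].

Lemma EGZ_length_exists (G : finZmodType) : exists m, EGZ_length G m.
Proof.
set e := group_exp G.
exists (#|G| * e)%N; apply/forallP => s.
have e_gt0 : (0 < e)%N by rewrite /e group_expE exponent_gt0.
have G_gt0 : (0 < #|G|)%N by apply/card_gt0P; exists 0.
have [g hg] : exists g : G, (e <= count_mem g s)%N.
  apply/existsP; apply: contraT; rewrite negb_exists => /forallP h.
  have := size_tuple s; rewrite -sum1_size (partition_big id xpredT) //=.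
  move=> hs; suff : (\sum_(j : G) \sum_(i <- s | i == j) 1 < \sum_(j : G) e)%N.
    by rewrite hs sum_nat_const ltnn.
  rewrite (bigD1 (0 : G)) //= [X in (_ < X)%N](bigD1 (0 : G)) //= -addSn.
  apply: leq_add; first by rewrite sum1_count ltnNge; exact: h.
  by apply: leq_sum => i _; rewrite sum1_count ltnW // ltnNge; exact: h.
apply/existsP; exists (nseq_tuple e g); apply/andP; split.
  apply: (@subseq_trans _ (filter (pred1 g) s)); last exact: filter_subseq.
  have /all_pred1P -> := filter_all (pred1 g) s.
  by rewrite size_filter /= -[count _ _](subnK hg) nseqD suffix_subseq.
rewrite /= big_nseq -Monoid.iteropE -[iterop _ _ _ _]/(g *+ e) -FinRing.zmodXgE.
rewrite /e group_expE.
by apply/eqP/expg_exponent; rewrite in_setT.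
Qed.

Definition EGZ (G : finZmodType) : nat := ex_minn (EGZ_length_exists G).

(* The ring notation ['Z_k] would denote Z/2Z when k = 1; ['I_k.-1.+1] is the
   cyclic group of order k for every k > 0. *)
Definition Zmod_pow (k n : nat) : finZmodType := 'rV['I_k.-1.+1]_n.

(* 1 = p ^ 0 counts as a prime power: this only matters for k = 1, where it
   gives q = 1. *)
Definition prime_power (d : nat) : Prop :=
  exists p e : nat, prime p /\ d = (p ^ e)%N.

Definition largest_prime_power_divisor (k q : nat) : Prop :=
  [/\ prime_power q, (q %| k)%N
    & forall d : nat, prime_power d -> (d %| k)%N -> (d <= q)%N].

From mathcomp Require Import all_classical all_reals all_analysis.
From mathcomp Require Import ring lra.
Import numFieldNormedType.Exports.
Local Open Scope classical_set_scope.
Local Open Scope ring_scope.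

Definition is_minimum (R : realType) (A : set R) (m : R) : Prop :=
  A m /\ lbound A m.

Definition minimum (R : realType) (A : set R) : R := get (is_minimum A).

Definition J_fun (R : realType) (q : nat) (x : R) : R :=
  (1 - x ^+ q) / (1 - x) * x `^ (- ((q%:R - 1) / 3)).

(* The minimum is attained, so [minimum] in [J] never takes its default value. *)
Lemma J_fun_minimum (R : realType) (q : nat) : (0 < q)%N ->
  exists m, is_minimum (@J_fun R q @` `]0, 1[) m.
Proof.
move=> q0.
have [q1|q1] := leqP q 1%N.
  have -> : q = 1%N by apply/eqP; rewrite eqn_leq q1.
  have J1 (x : R) : x \in `]0, 1[ -> J_fun 1 x = 1.
    rewrite in_itv /= => /andP[x0 x1].
    by rewrite /J_fun expr1 divff ?subr_eq0 ?gt_eqF// subrr mul0r oppr0 powRr0 mulr1.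
  exists 1; split; first by exists 2^-1; rewrite ?J1//= in_itv/=; lra.
  by move=> _ [x x01 <-]; rewrite J1.
pose a : R := (q%:R - 1) / 3.
pose G (x : R) := (\sum_(i < q) x ^+ i) * x `^ (- a).
have q1R : 1 < q%:R :> R by rewrite ltr1n.
have a0 : 0 < a by rewrite /a; lra.
have JG x : x \in `]0, 1[ -> J_fun q x = G x.
  rewrite in_itv /= => /andP[x0 x1]; rewrite /J_fun /G; congr (_ * _).
  have x1' : 1 - x != 0 by rewrite subr_eq0 gt_eqF.
  by rewrite -{1}(expr1n R q) subrXX mulrC mulKf//; apply: eq_bigr => i _; rewrite expr1n mul1r.
have G1 : G 1 = q%:R.
  rewrite /G powR1 mulr1; under eq_bigr do rewrite expr1n.
  by rewrite sumr_const card_ord.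
have dG (x : R) : 0 < x -> is_derive x 1 G
   ((\sum_(i < q) x ^+ i) * (- a * x `^ (- a - 1)) + x `^ (- a) * (\sum_(i < q) i%:R * x ^+ i.-1)).
  move=> x0.
  have dP : is_derive x 1 (fun x : R => \sum_(i < q) x ^+ i) (\sum_(i < q) i%:R * x ^+ i.-1).
    rewrite (_ : (fun x : R => \sum_(i < q) x ^+ i) = \sum_(i < q) (fun x : R => x ^+ i)); last first.
      by apply/funext => y; rewrite fct_sumE.
    apply: is_derive_sum => i.
    have := @is_deriveX R R id i x 1 1 (is_derive_id x 1).
    rewrite /GRing.scale /= mulr1.
    by rewrite (_ : id ^+ i = (fun x : R => x ^+ i))// ; apply/funext => y; rewrite fctE.
  have dR := is_derive1_powR (- a) x0.
  exact: (is_deriveM dP dR).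
have [t t01 Gt] : exists2 t, t \in `]0, 1[ & G t < G 1.
  have d1 := dG 1 ltr01.
  have : 0 < 'D_1 G 1.
    rewrite derive_val !powR1 mulr1 mul1r.
    have -> : \sum_(i < q) (1 : R) ^+ i = q%:R.
      by under eq_bigr do [rewrite expr1n]; rewrite sumr_const card_ord.
    have -> : \sum_(i < q) (i%:R : R) * 1 ^+ i.-1 = (\sum_(i < q) i)%:R.
      by rewrite natr_sum; apply: eq_bigr => i _; rewrite expr1n mulr1.
    have -> : (\sum_(i < q) i)%N = 'C(q, 2) by rewrite -(big_mkord xpredT id) bin2_sum.
    have h : ('C(q,2))%:R *+ 2 = q%:R * (q%:R - 1) :> R.
      rewrite -mulrnA muln2 bin2 halfK oddM. 
      have -> : odd q && odd q.-1 = false by case: (q) q0 => //= n _; case: odd.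
      by rewrite subn0 natrM -subn1 natrB.
    rewrite /a; nra.
  move=> d0.
  have /cvgr_gt := (@ex_derive _ _ _ _ _ _ _ d1).
  move=> /(_ 0 d0).
  rewrite near_withinE => -[e /= e0 he].
  pose h : R := Num.min (e / 2) (1/2).
  have h0 : 0 < h by rewrite lt_min; apply/andP; split; lra.
  have he' : h < e by rewrite gt_min; apply/orP; left; lra.
  have h1 : h < 1 by rewrite gt_min; apply/orP; right; lra.
  exists (1 - h); first by rewrite in_itv /=; lra.
  have := he (- h); rewrite /= sub0r opprK gtr0_norm// => /(_ he').
  rewrite oppr_eq0 gt_eqF// => /(_ isT).
  rewrite /GRing.scale /= mulr1 addrC invrN mulNr oppr_gt0.
  by rewrite pmulr_rlt0 ?invr_gt0// [- h + 1]addrC addrC subr_lt0.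
have [c c01 cG] : exists2 c, c \in `]0, 1[ & forall x, 0 < x < c -> G 1 <= G x.
  exists (q%:R `^ (- a^-1)).
    rewrite in_itv /= powR_gt0 ?powRN; last lra.
    rewrite invf_lt1 ?powR_gt0//; last lra.
    have := @gt0_ltr_powR R a^-1 _ 1 q%:R; rewrite invr_gt0 a0 powR1.
    by apply; rewrite ?nnegrE.
  move=> x /andP[x0 xc].
  have h : q%:R <= x `^ (- a).
    have : x `^ a <= (q%:R `^ (- a^-1)) `^ a.
      by apply: ge0_ler_powR; rewrite ?nnegrE ?powR_ge0 ?ltW.
    rewrite -powRrM mulNr mulVf ?gt_eqF// !powRN powRr1 ?ler0n// => h.
    by rewrite -[leLHS]invrK lef_pV2 ?posrE ?invr_gt0 ?powR_gt0//; lra.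
  rewrite G1 (le_trans h)// /G ler_peMl ?powR_ge0//.
  rewrite -(prednK q0) big_ord_recl expr0 lerDl.
  by apply: sumr_ge0 => i _; rewrite exprn_ge0// ltW.
have [c0 c1] : 0 < c /\ c < 1 by move: c01; rewrite in_itv /= => /andP.
have cG' : {within `[c, 1], continuous G}.
  apply: derivable_within_continuous => x; rewrite in_itv /= => /andP[cx _].
  by have d := dG x (lt_le_trans c0 cx); exact: ex_derive.
have [m m01 hm] := EVT_min (ltW c1) cG'.
have Gm1 : G m <= G 1 by apply: hm; rewrite in_itv /= lexx ltW.
have Gmin x : x \in `]0, 1[ -> G m <= G x.
  rewrite in_itv /= => /andP[x0 x1]; have [cx|xc] := leP c x.
    by apply: hm; rewrite in_itv /= cx ltW.
  by rewrite (le_trans Gm1)// cG// x0.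
have m01' : m \in `]0, 1[.
  move: m01; rewrite !in_itv /= => /andP[cm]; rewrite le_eqVlt => /orP[/eqP m1|->].
    by have := Gmin _ t01; rewrite m1 leNgt Gt.
  by rewrite (lt_le_trans c0 cm).
exists (G m); split; first by exists m => //; rewrite JG.
by move=> _ [x x01 <-]; rewrite JG// Gmin.
Qed.

Definition J (R : realType) (q : nat) : R :=
  q%:R^-1 * minimum (@J_fun R q @` `]0, 1[).

(* The bound EGZ (Zmod_pow k n) <= (J q * q + o(1)) ^ n fails for k = q = 2:
   there EGZ (Zmod_pow 2 n) = 2 ^ n + 1 for n > 0, while
   J 2 * 2 = (3 / 2) * 2 ^ (1 / 3) < 19 / 10. *)

(* Main.v *)
Require Import Defs.
From mathcomp Require Import all_boot all_order all_algebra all_fingroup.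
From mathcomp Require Import all_solvable all_field ring zify lra.

Set Implicit Arguments.
Unset Strict Implicit.
Unset Printing Implicit Defensive.

Import Order.TTheory GRing.Theory Num.Theory.
Local Open Scope ring_scope.

(* Let B = J(q) q.  Zero-sum bounds O(B ^ n) for the moduli p and k give one for
   p k: extract disjoint zero-sums of length p modulo p, divide their sums by p,
   and apply the bound for k.  This reduces k to its prime factors p <= q.  For
   p = 2 pigeonhole gives 2 ^ n + 1, and 2 <= B because an even k <> 2 has
   q >= 3.  For odd p, following Fox and Sauermann, one reduces to sets without
   three-term arithmetic progressions, whose size is at most 3 (J(p) p) ^ n by
   the slice rank argument of Ellenberg, Gijswijt and Tao; and J(p) p <= J(q) q
   because x ^ (- (q - 1) / 3) (1 + ... + x ^ (q - 1)) is pointwise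
   nondecreasing in q on ]0, 1[. *)

(** * Slice rank of diagonal tensors *)

(* Contract the tensor along x with a vector h killing the first sum and equal to
   1 on at least N - m coordinates: the identity matrix on those coordinates
   then has rank at most 2 m. *)
Lemma slice_rank_diag_ord (F : fieldType) (N m : nat) (f1 f2 f3 : 'M[F]_(N, m))
    (g1 g2 g3 : 'I_m -> 'I_N -> 'I_N -> F) :
  (forall x y z, ((x == y) && (y == z))%:R =
     \sum_i f1 x i * g1 i y z + \sum_i f2 y i * g2 i x z
     + \sum_i f3 z i * g3 i x y) ->
  (N <= 3 * m)%N.
Proof.
move=> diagE.
(* The rows of [row_base (kermx f1)] form a basis of the left kernel of [f1]. The coordinates
   selected by [phi] determine a kernel vector, so [h] can be prescribed to be 1 on all of them. *)
have Kfull : row_full (row_base (kermx f1))^T.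
  by rewrite /row_full mxrank_tr; exact: row_base_free.
set phi := fullrankfun Kfull.
pose P := rowsub phi (row_base (kermx f1))^T.
have Punit : P \in unitmx by exact: fullrowsub_unit.
pose u := invmx P *m (const_mx 1 : 'cV_(\rank (kermx f1))).
pose h := u^T *m row_base (kermx f1).
have hf1 : h *m f1 = 0.
  apply/sub_kermxP; apply: submx_trans (submxMl _ _) _.
  by rewrite eq_row_base.
have h1 t : h 0 (phi t) = 1.
  have /matrixP/(_ t 0) : P *m u = const_mx 1 by rewrite mulKVmx.
  by rewrite !mxE => <-; apply: eq_bigr => j _; rewrite !mxE mulrC.
pose C := \matrix_(i < m, t < \rank (kermx f1)) \sum_x h 0 x * g2 i x (phi t).
pose D := \matrix_(s < \rank (kermx f1), i < m) \sum_x h 0 x * g3 i x (phi s).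
have idE : 1%:M = rowsub phi f2 *m C + D *m (rowsub phi f3)^T.
  apply/matrixP => s t; rewrite !mxE.
  have -> : (s == t)%:R = \sum_x h 0 x * ((x == phi s) && (phi s == phi t))%:R.
    rewrite (bigD1 (phi s)) //= big1 => [|x /negPf ->]; last by rewrite mulr0.
    by rewrite h1 eqxx mul1r addr0 (inj_eq (@fullrankfun_inj _ _ _ _ Kfull)).
  under eq_bigr do rewrite diagE !mulrDr.
  rewrite !big_split /=; set S1 := (X in X + _ + _).
  have -> : S1 = 0.
    rewrite /S1; under eq_bigr do rewrite mulr_sumr.
    rewrite exchange_big big1 //= => i _.
    under eq_bigr do rewrite mulrA.
    rewrite -mulr_suml; have /matrixP/(_ 0 i) := hf1.
    by rewrite !mxE => ->; rewrite mul0r.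
  rewrite add0r; congr (_ + _).
    under eq_bigr do rewrite mulr_sumr.
    rewrite exchange_big /=; apply: eq_bigr => i _; rewrite !mxE mulr_sumr.
    by apply: eq_bigr => x _; rewrite mulrCA.
  under eq_bigr do rewrite mulr_sumr.
  rewrite exchange_big /=; apply: eq_bigr => i _; rewrite !mxE mulr_suml.
  by apply: eq_bigr => x _; rewrite mulrCA mulrC.
have : (\rank (kermx f1) <= m + m)%N.
  rewrite -[X in (X <= _)%N](mxrank1 F) idE (leq_trans (mxrank_add _ _)) //.
  by rewrite leq_add ?mulmx_max_rank.
rewrite mxrank_ker leq_subLR => /leq_trans; apply.
by rewrite mulSn mul2n -addnn leq_add2r rank_leq_col.
Qed.

Lemma slice_rank_diag (F : fieldType) (X M : finType) (B : {set X}) (L : {set M})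
    (f1 f2 f3 : M -> X -> F) (g1 g2 g3 : M -> X -> X -> F) :
  {in B & B & B, forall x y z, ((x == y) && (y == z))%:R =
     \sum_(a in L) f1 a x * g1 a y z + \sum_(a in L) f2 a y * g2 a x z
     + \sum_(a in L) f3 a z * g3 a x y} ->
  (#|B| <= 3 * #|L|)%N.
Proof.
move=> diagE.
pose mx (f : M -> X -> F) :=
  \matrix_(x < #|B|, i < #|L|) f (enum_val i) (enum_val x).
pose tr (g : M -> X -> X -> F) (i : 'I_#|L|) (y z : 'I_#|B|) :=
  g (enum_val i) (enum_val y) (enum_val z).
apply: (@slice_rank_diag_ord F _ _ (mx f1) (mx f2) (mx f3) (tr g1) (tr g2) (tr g3)).
move=> x y z.
have := diagE _ _ _ (enum_valP x) (enum_valP y) (enum_valP z).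
rewrite !(inj_eq enum_val_inj) => ->.
by congr (_ + _ + _); rewrite big_enum_val; apply: eq_bigr => i _; rewrite mxE.
Qed.

(** * Progression-free sets over a finite field *)

Definition low_exponents (d n : nat) : {set {ffun 'I_n -> 'I_d.+1}} :=
  [set a : {ffun 'I_n -> 'I_d.+1} | (3 * \sum_j a j <= d * n)%N].

Definition monomial (F : fieldType) (d n : nat) (a : {ffun 'I_n -> 'I_d.+1})
  (x : 'rV[F]_n) : F := \prod_j x 0 j ^+ a j.

(* The last exponent is [minn i j]; this makes the total degree [d] even in the
   terms with [i < j], whose coefficient is 0. *)
Lemma expr_trinomial (F : fieldType) (d : nat) (x y z : F) :
  (x + (y + z)) ^+ d =
  \sum_(i < d.+1) \sum_(j < d.+1) ('C(d, i) * 'C(i, j))%:R *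
     (x ^+ (d - i) * y ^+ (i - j) * z ^+ (i - (i - j))).
Proof.
rewrite exprDn; apply: eq_bigr => i _.
rewrite exprDn.
rewrite (big_ord_widen _ (fun j => y ^+ (i - j) * z ^+ j *+ 'C(i, j)) (ltn_ord i)).
rewrite big_mkcond /= mulr_sumr -mulr_natl mulr_sumr.
apply: eq_bigr => j _; case: ltnP => [|ij]; last first.
  by rewrite (bin_small ij) muln0 mul0r !mulr0.
by rewrite ltnS => /subKn ->; rewrite natrM -[_ *+ _]mulr_natl; ring.
Qed.

(** Nonzero elements of [F] have order dividing [#|F|.-1], so vanishing is detected by a polynomial
    of that degree. *)
Lemma one_sub_exprE (F : finFieldType) (u : F) :
  1 - u ^+ #|F|.-1 = (u == 0)%:R.
Proof.
have F_gt1 := finNzRing_gt1 F.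
have [->|u0] := eqVneq; first by rewrite expr0n gtn_eqF ?subr0 // -subn1 subn_gt0.
apply/eqP; rewrite subr_eq0 eq_sym; apply/eqP/(mulIf u0).
by rewrite -exprSr prednK ?expf_card ?mul1r // ltnW.
Qed.

(* Each summand below has total degree at most [d * n], so one of its three
   monomials has degree at most [d * n / 3]. *)
Lemma line_indicatorE (F : finFieldType) (n : nat)
    (T := option ('I_#|F|.-1.+1 * 'I_#|F|.-1.+1)) :
  exists (c : {ffun 'I_n -> T} -> F)
    (e1 e2 e3 : {ffun 'I_n -> T} -> {ffun 'I_n -> 'I_#|F|.-1.+1}),
  (forall g, [|| e1 g \in low_exponents #|F|.-1 n, e2 g \in low_exponents #|F|.-1 n
     | e3 g \in low_exponents #|F|.-1 n]) /\
  forall x y z : 'rV[F]_n, (x + z == y + y)%:R =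
    \sum_g c g * (monomial (e1 g) x * monomial (e2 g) y * monomial (e3 g) z).
Proof.
set d := #|F|.-1.
(* [None] stands for the constant 1 and [Some (i, j)] for a trinomial term of
   [1 - (x - 2 y + z) ^+ d]; a function [g] chooses one of them in each coordinate. *)
pose k1 (t : T) : 'I_d.+1 := if t is Some (i, j) then inord (d - i) else ord0.
pose k2 (t : T) : 'I_d.+1 := if t is Some (i, j) then inord (i - j) else ord0.
pose k3 (t : T) : 'I_d.+1 := if t is Some (i, j) then inord (i - (i - j)) else ord0.
pose k (t : T) : F :=
  if t is Some (i, j) then - ('C(d, i) * 'C(i, j))%:R * (- 2%:R) ^+ (i - j) else 1.
have k_le t : (k1 t + k2 t + k3 t <= d)%N.
  case: t => [[i j]|] //=; have := leq_ord i => id.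
  rewrite !inordK ?ltnS ?leq_subr // ?(leq_trans (leq_subr _ _)) //.
  by rewrite -addnA subnKC ?leq_subr // subnK.
have kE (x y z : F) : (x + z == y + y)%:R =
    \sum_t k t * (x ^+ k1 t * y ^+ k2 t * z ^+ k3 t).
  have -> : (x + z == y + y) = (x + (- 2%:R * y + z) == 0).
    by rewrite -subr_eq0; congr (_ == _); ring.
  rewrite -one_sub_exprE -/d expr_trinomial.
  rewrite (bigD1 None) //= !expr0 !mulr1; congr (_ + _).
  rewrite pair_big /= -sumrN.
  rewrite [RHS](reindex_omap (fun p : 'I_d.+1 * 'I_d.+1 => Some p) id) => [|[p|]] //.
  apply: eq_big => [p|[i j] _] /=; first by rewrite eqxx.
  have id := leq_ord i.
  rewrite !inordK ?ltnS ?leq_subr // ?(leq_trans (leq_subr _ _)) //.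
  by rewrite exprMn; ring.
exists (fun g => \prod_j k (g j)), (fun g => [ffun j => k1 (g j)]),
  (fun g => [ffun j => k2 (g j)]), (fun g => [ffun j => k3 (g j)]).
split=> [g|x y z].
  have sumE (k' : T -> 'I_d.+1) :
      (\sum_j [ffun i => k' (g i)] j = \sum_j k' (g j))%N.
    by apply: eq_bigr => j _; rewrite ffunE.
  rewrite !inE !sumE; apply: contraT; rewrite !negb_or -!ltnNge => /and3P[h1 h2 h3].
  have : (\sum_j k1 (g j) + \sum_j k2 (g j) + \sum_j k3 (g j) <= d * n)%N.
    rewrite -!big_split /= mulnC -[X in (_ <= X * d)%N]card_ord -sum_nat_const.
    exact: leq_sum.
  lia.
(* The indicator factors over the coordinates, and multiplying out the expansions [kE] gives a sum
   over [g]. *)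
have -> : (x + z == y + y)%:R = \prod_j (x 0 j + z 0 j == y 0 j + y 0 j)%:R :> F.
  have [xyz|/eqP xyz] := boolP (x + z == y + y).
    rewrite big1 // => j _; move/eqP/rowP/(_ j): xyz.
    by rewrite !mxE => ->; rewrite eqxx.
  have [/forallP h|] := boolP [forall j, x 0 j + z 0 j == y 0 j + y 0 j].
    by case: xyz; apply/rowP => j; rewrite !mxE; apply/eqP.
  by rewrite negb_forall => /existsP[j /negPf hj]; rewrite (bigD1 j) //= hj mul0r.
under eq_bigr do rewrite kE.
rewrite bigA_distr_bigA; apply: eq_bigr => g _.
rewrite big_split /=; congr (_ * _); rewrite !big_split /=.
by congr (_ * _ * _); apply: eq_bigr => j _; rewrite ffunE.
Qed.

(** On [B] the diagonal tensor is the indicator of x + z = 2 y. Each term of its expansion is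
    assigned to the first of its three exponent vectors that is low; the terms sharing that vector
    form one slice. *)
Lemma cap_set_bound (F : finFieldType) (n : nat) (B : {set 'rV[F]_n}) :
  {in B & B & B, forall x y z, x + z = y + y -> x = y} ->
  (#|B| <= 3 * #|low_exponents #|F|.-1 n|)%N.
Proof.
move=> capB; set L := low_exponents _ _.
have [c [e1 [e2 [e3 [low E]]]]] := line_indicatorE F n.
pose h1 a y z := \sum_(g | (e1 g \in L) && (e1 g == a))
  c g * (monomial (e2 g) y * monomial (e3 g) z).
pose h2 a x z := \sum_(g | (e1 g \notin L) && (e2 g \in L) && (e2 g == a))
  c g * (monomial (e1 g) x * monomial (e3 g) z).
pose h3 a x y := \sum_(g | (e1 g \notin L) && (e2 g \notin L) && (e3 g == a))
  c g * (monomial (e1 g) x * monomial (e2 g) y).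
pose f (a : {ffun 'I_n -> 'I_#|F|.-1.+1}) (x : 'rV[F]_n) := monomial a x.
apply: (@slice_rank_diag F _ _ B L f f f h1 h2 h3) => x y z xB yB zB.
have -> : (x == y) && (y == z) = (x + z == y + y).
  apply/andP/eqP => [[/eqP -> /eqP ->] //|xyz].
  have xy := capB _ _ _ xB yB zB xyz; move: xyz; rewrite xy => /addrI ->.
  by rewrite !eqxx.
rewrite E (bigID (fun g => e1 g \in L)) /=.
rewrite [X in _ + X](bigID (fun g => e2 g \in L)) /= addrA.
congr (_ + _ + _).
- rewrite (partition_big e1 (mem L)) //=; apply: eq_bigr => a _.
  by rewrite mulr_sumr; apply: eq_bigr => g /andP[_ /eqP <-]; rewrite /f; ring.
- rewrite (partition_big e2 (mem L)) => [|g /andP[]] //=; apply: eq_bigr => a _.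
  by rewrite mulr_sumr; apply: eq_bigr => g /andP[_ /eqP <-]; rewrite /f; ring.
- rewrite (partition_big e3 (mem L)) => [|g /andP[g1 g2]] /=; last first.
    by have := low g; rewrite (negPf g1) (negPf g2).
  apply: eq_bigr => a _.
  by rewrite mulr_sumr; apply: eq_bigr => g /andP[_ /eqP <-]; rewrite /f; ring.
Qed.

(** * Choosing subsets: sections, independent sets, reflected pairs *)

Lemma subset_of_card (T : finType) (A : {set T}) (k : nat) : (k <= #|A|)%N ->
  exists2 S : {set T}, S \subset A & #|S| = k.
Proof.
move=> /card_geqP[s [us sz sA]]; exists [set x in s].
  by apply/subsetP => x; rewrite inE => /sA.
by rewrite cardsE (card_uniqP us).
Qed.

(** This lifts a set of distinct points to indices, one for each point, so that size and sum are
    preserved. *)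
Lemma imset_section (I V : finType) (f : I -> V) (U : {set I}) (E : {set V}) :
  E \subset f @: U ->
  exists S : {set I}, [/\ S \subset U, {in S &, injective f} & f @: S = E].
Proof.
move=> EU.
(* The outcome of [pick] depends only on the value [f i], so one index per value survives. *)
exists [set i in U | (f i \in E) && (Some i == [pick j in U | f j == f i])].
split=> [|i i'|].
- by apply/subsetP => i; rewrite inE => /andP[].
- rewrite !inE => /and3P[_ _ /eqP ei] /and3P[_ _ /eqP ei'] fE.
  by apply: Some_inj; rewrite ei ei' fE.
- apply/setP => w; apply/imsetP/idP => [[i]|wE].
    by rewrite inE => /and3P[_ iE _] ->.
  have /imsetP[i iU wi] := subsetP EU w wE.
  have : [pick j in U | f j == f i] != None.
    by case: pickP => // /(_ i); rewrite iU eqxx.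
  case pj: [pick j in U | f j == f i] => [j|//] _; exists j.
    move: (pj); case: pickP => // j' /andP[jU /eqP fj] [jj]; subst j'.
    by rewrite inE jU fj -wi wE wi pj /=.
  by move: pj; case: pickP => // j' /andP[jU /eqP fj] [<-]; rewrite fj.
Qed.

(** In-degrees and out-degrees have the same average, so some vertex has in-degree at most [d]. Keep
    it, delete it and its at most 2 d neighbours from [A], and iterate. *)
Lemma greedy_independent_set (V : finType) (e : rel V) (d : nat) (A : {set V}) :
  {in A, forall y, (#|[set x in A | e y x]| <= d)%N} ->
  exists B : {set V}, [/\ B \subset A, {in B &, forall x y, e x y -> x = y}
     & (#|A| <= d.*2.+1 * #|B|)%N].
Proof.
have [c] := ubnP #|A|; elim: c A => // c IH A Ac outd.
have [->|A0] := eqVneq A set0.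
  by exists set0; split=> [|x y|]; rewrite ?sub0set ?inE ?cards0.
have [y yA ind] : exists2 y, y \in A & (#|[set x in A | e x y]| <= d)%N.
  apply/exists_inP; apply: contraT; rewrite negb_exists_in => /forall_inP h.
  have : (\sum_(y in A) d.+1 <= \sum_(y in A) #|[set x in A | e x y]|)%N.
    by apply: leq_sum => y /h; rewrite -ltnNge.
  have -> : (\sum_(y in A) #|[set x in A | e x y]| =
      \sum_(x in A) #|[set y in A | e x y]|)%N.
    have cE (P : pred V) : #|[set x in A | P x]| = (\sum_(x in A) P x)%N.
      rewrite -sum1_card big_mkcond [RHS]big_mkcond; apply: eq_bigr => x _.
      by rewrite inE; case: (x \in A); case: (P x).
    under eq_bigr do rewrite cE.
    by rewrite exchange_big; apply: eq_bigr => x _; rewrite cE.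
  have h' : (\sum_(x in A) #|[set y in A | e x y]| <= \sum_(x in A) d)%N.
    exact: leq_sum.
  move/leq_trans => /(_ _ h'); rewrite !sum_nat_const leq_pmul2l ?ltnn //.
  by rewrite lt0n cards_eq0.
pose N := y |: ([set x in A | e y x] :|: [set x in A | e x y]).
have cN : (#|N| <= d.*2.+1)%N.
  rewrite /N cardsU1 -add1n leq_add ?leq_b1 //.
  by rewrite (leq_trans (leq_card_setU _ _)) // -addnn leq_add // outd.
have [||B [BA indep AB]] := IH (A :\: N).
- rewrite -ltnS; apply: leq_trans Ac; rewrite ltnS.
  apply: proper_card; apply/properP; split; first exact: subsetDl.
  by exists y; rewrite // !inE eqxx.
- move=> x; rewrite inE => /andP[_ xA]; apply: leq_trans (outd x xA).
  by apply: subset_leq_card; apply/subsetP => z; rewrite !inE => /andP[/andP[_ ->] ->].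
have BN x : x \in B -> [/\ x \in A, x != y, ~~ e y x & ~~ e x y].
  move/(subsetP BA); rewrite !inE !negb_or => /andP[/and3P[-> h1 h2] xA].
  by move: h1 h2; rewrite xA.
exists (y |: B); split.
- apply/subsetP => x; rewrite !inE => /predU1P[->|/BN[]] //.
- move=> x z; rewrite !inE => /predU1P[->|xB] /predU1P[->|zB] //; last exact: indep.
    by case: (BN _ zB) => _ _ /negPf ->.
  by case: (BN _ xB) => _ _ _ /negPf ->.
- have yB : y \notin B by apply/negP => /BN[_]; rewrite eqxx.
  rewrite cardsU1 yB mulnDr muln1 -(cardsID N A) leq_add //.
  by rewrite (leq_trans _ cN) // subset_leq_card // subsetIr.
Qed.

(** Reflection in [y] is an involution of [D] without fixed points; its orbits are pairs of sum 2 y,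
    and [h] of them are collected. *)
Lemma reflection_closed_subset (V : finZmodType) (y : V) (h : nat) (D : {set V}) :
  {in D, forall x, (y + y - x \in D) && (y + y - x != x)} -> (h.*2 <= #|D|)%N ->
  exists2 E : {set V}, E \subset D & #|E| = h.*2 /\ \sum_(x in E) x = y *+ h.*2.
Proof.
elim: h D => [|h IH] D Dsym hD.
  by exists set0; rewrite ?sub0set // cards0 big_set0 mulr0n.
have /card_gt0P[x xD] : (0 < #|D|)%N by exact: leq_trans hD.
have /andP[x'D x'x] := Dsym x xD.
set x' := y + y - x in x'D x'x.
have x'K : y + y - x' = x by rewrite /x' subKr.
have [||E ED [cE sE]] := IH (D :\: [set x; x']).
- move=> z; rewrite !inE negb_or => /andP[/andP[zx zx'] zD].
  have /andP[-> ->] := Dsym z zD; rewrite !andbT negb_or.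
  apply/andP; split; apply/eqP => zE.
    by move: zx'; rewrite /x' -zE subKr eqxx.
  by move: zx; rewrite -x'K -zE subKr eqxx.
- rewrite cardsD (_ : D :&: _ = [set x; x']); last first.
    by apply/setIidPr/subsetP => z; rewrite !inE => /orP[] /eqP ->.
  by rewrite cards2 eq_sym x'x leq_subRL ?(leq_trans _ hD) // -doubleS.
have xE : x \notin E by apply/negP => /(subsetP ED); rewrite !inE eqxx.
have x'E : x' \notin E by apply/negP => /(subsetP ED); rewrite !inE eqxx orbT.
have xx'E : x \notin x' |: E by rewrite !inE negb_or eq_sym x'x.
exists (x |: (x' |: E)).
  apply/subsetP => z; rewrite !inE => /or3P[/eqP ->|/eqP ->|/(subsetP ED)] //.
  by rewrite inE => /andP[].
split; first by rewrite !cardsU1 xx'E x'E cE.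
by rewrite !big_setU1 //= sE addrA /x' [x + _]addrC subrK doubleS !mulrS addrA.
Qed.

(** * Zero-sums of prescribed length and products of moduli *)

(* Multiplicities of sequences are carried by the index type [I], and classes
   modulo [k] are represented by natural numbers so that sums can be divided. *)
Definition egz_prop (k n m : nat) : Prop :=
  forall (I : finType) (v : I -> 'I_n -> nat) (U : {set I}), (m <= #|U|)%N ->
  exists S : {set I}, [/\ S \subset U, #|S| = k
    & forall j, (k %| \sum_(i in S) v i j)%N].

(* A point [y] of a sequence over F_p that is the midpoint of (p - 1) / 2
   disjoint pairs of other points yields a zero-sum of length p; if no point is
   such a midpoint, a positive proportion of the points contains no
   three-term arithmetic progression. *)
Lemma egz_odd_prime (p n m : nat) : prime p -> odd p ->
  (p * (p.*2 * (3 * #|low_exponents p.-1 n|)) < m)%N -> egz_prop p n m.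
Proof.
move=> pr oddp pm I v U mU.
have p_gt0 := prime_gt0 pr.
have charp := pchar_Fp pr.
pose r i : 'rV['F_p]_n := \row_j (v i j)%:R.
suff [S [SU cS sS]] : exists S : {set I},
    [/\ S \subset U, #|S| = p & \sum_(i in S) r i = 0].
  exists S; split=> // j; rewrite (dvdn_pcharf charp) natr_sum.
  have /rowP/(_ j) := sS; rewrite summxE mxE => sSj; rewrite -[X in _ == X]sSj.
  by apply/eqP/eq_bigr => i _; rewrite mxE.
have rp0 (w : 'rV['F_p]_n) : w *+ p = 0.
  by apply/rowP => j; rewrite mulmxnE mxE -mulr_natr (pcharf0 charp) mulr0.
(* A value taken [p] times gives a zero-sum at once; otherwise passing to the set [A] of values
   costs only a factor [p]. *)
have [/existsP[w hw]|] := boolP [exists w, (p <= #|[set i in U | r i == w]|)%N].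
  have [S SU cS] := subset_of_card hw; exists S; split=> //.
    by apply: subset_trans SU _; apply/subsetP => i; rewrite inE => /andP[].
  rewrite (eq_bigr (fun=> w)) ?sumr_const ?cS // => i /(subsetP SU).
  by rewrite inE => /andP[_ /eqP].
rewrite negb_exists => /forallP fib; set A := r @: U.
have UA : (#|U| <= p * #|A|)%N.
  rewrite -sum1_card (partition_big r (mem A)) => [|i iU] /=; last exact: imset_f.
  rewrite mulnC -sum_nat_const leq_sum // => w _; rewrite sum1_card ltnW //.
  have := fib w; rewrite -ltnNge; congr (_ < _)%N.
  by apply: eq_card => i; rewrite !inE.
pose D y := [set x in A | (y + y - x \in A) && (x != y)].
(* If [D y] is large, (p - 1) / 2 reflected pairs together with [y] itself have sum p y = 0. *)
have [/exists_inP[y yA hy]|] := boolP [exists y in A, (p.-1 <= #|D y|)%N].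
  have p1 : p.-1 = p./2.*2 by rewrite -[p in p.-1]odd_double_half oddp.
  have two0 : 2%:R != 0 :> 'F_p.
    rewrite -(dvdn_pcharf charp); apply/negP => /dvdn_leq /= /(_ isT) p2.
    have p_eq2 : p = 2 by apply/eqP; rewrite eqn_leq p2 prime_gt1.
    by move: oddp; rewrite p_eq2.
  have double_inj : injective (fun w : 'rV['F_p]_n => w + w).
    move=> w w' /rowP ww'; apply/rowP => j; have := ww' j; rewrite !mxE -!mulr2n.
    by rewrite -[w 0 j *+ 2]mulr_natr -[w' 0 j *+ 2]mulr_natr => /(mulIf two0).
  have [||E ED [cE sE]] := @reflection_closed_subset _ y p./2 (D y).
  - move=> x; rewrite !inE => /and3P[xA x'A xy]; rewrite x'A subKr xA /=.
    apply/andP; split; apply: contraNneq xy => h.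
      by apply/eqP; rewrite -[x](subKr (y + y)) h addrK.
    by apply/eqP/double_inj; rewrite -{1}h subrK.
  - by rewrite -p1.
  have yE : y \notin E by apply/negP => /(subsetP ED); rewrite !inE eqxx !andbF.
  have [|S [SU rinj SE]] := @imset_section _ _ r U (y |: E).
    apply/subsetP => w; rewrite !inE => /predU1P[->|/(subsetP ED)] //.
    by rewrite inE => /andP[].
  exists S; split=> //.
    by rewrite -(card_in_imset rinj) SE cardsU1 yE cE -p1 add1n prednK.
  rewrite -(big_imset id rinj) /= SE big_setU1 //= sE -p1 -mulrS prednK //.
rewrite negb_exists_in => /forall_inP hD.
(* All out-degrees are now below [p.-1]. A solution of x + z = 2 y with x different from y gives an
   edge from [y] to [x], so an independent set contains none. *)
pose e y x := (y + y - x \in A) && (x != y).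
have [y yA|B [BA indep AB]] := @greedy_independent_set _ e p.-1 A.
  by rewrite ltnW // ltnNge; exact: hD.
have capB : {in B & B & B, forall x y z, x + z = y + y -> x = y}.
  move=> x y z xB yB zB xyz; apply/eqP; apply: contraT => xy.
  have : e y x by rewrite /e -xyz [x + z]addrC addrK xy (subsetP BA).
  by move/(indep y x yB xB) => h; rewrite h eqxx in xy.
have := cap_set_bound capB; rewrite card_Fp // => B3.
(* The greedy factor 2 (p - 1) + 1 is at most 2 p. *)
have AB' : (#|A| <= p.*2 * #|B|)%N.
  by apply: (leq_trans AB); rewrite leq_mul2r; apply/orP; right; lia.
have : (m <= p * (p.*2 * (3 * #|low_exponents p.-1 n|)))%N.
  apply: (leq_trans mU); apply: (leq_trans UA); rewrite leq_mul2l.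
  by apply/orP; right; apply: (leq_trans AB'); rewrite leq_mul2l B3 orbT.
by rewrite leqNgt pm.
Qed.

Lemma egz_two (n m : nat) : (2 ^ n < m)%N -> egz_prop 2 n m.
Proof.
move=> nm I v U mU.
pose r i : {ffun 'I_n -> bool} := [ffun j => odd (v i j)].
have /dinjectivePn[i iU [i' /andP[i'i i'U] rii']] : ~~ dinjectiveb r (mem U).
  apply/negP => /dinjectiveP rinj.
  have := max_card (mem (r @: U)); rewrite card_in_imset //.
  by rewrite card_ffun card_bool card_ord leqNgt (leq_trans nm mU).
exists [set i; i']; split; first by apply/subsetP => x; rewrite !inE => /orP[] /eqP ->.
  by rewrite cards2 eq_sym i'i.
move=> j; rewrite big_setU1 /= ?inE 1?eq_sym // big_set1 dvdn2 oddD.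
by have /ffunP/(_ j) := rii'; rewrite !ffunE => ->; rewrite addbb.
Qed.

Lemma egz_one (n m : nat) : (0 < m)%N -> egz_prop 1 n m.
Proof.
move=> m0 I v U /(leq_trans m0)/card_gt0P[i iU].
by exists [set i]; split; rewrite ?cards1 ?sub1set // => j; rewrite dvd1n.
Qed.

(** Greedy extraction: [t] zero-sums use up [a * t] indices, which leaves at least [m] for the next
    one. *)
Lemma egz_disjoint_family (a n m t : nat) (I : finType) (v : I -> 'I_n -> nat)
    (U : {set I}) : (0 < a)%N -> egz_prop a n m -> (a * t + m <= #|U|)%N ->
  exists F : {set {set I}}, [/\ #|F| = t, trivIset F, cover F \subset U &
    {in F, forall S : {set I}, #|S| = a /\ forall j, (a %| \sum_(i in S) v i j)%N}].
Proof.
move=> a0 egza; elim: t => [|t IH] hU.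
  exists set0; rewrite cards0 /cover big_set0 sub0set; split=> //.
    by apply/trivIsetP => S S'; rewrite inE.
  by move=> S; rewrite inE.
have [|F [cF tF FU Fa]] := IH.
  by apply: leq_trans hU; rewrite leq_add2r leq_mul2l leqnSn orbT.
have cc : #|cover F| = (a * t)%N.
  move: tF => /eqP <-; rewrite (eq_bigr (fun=> a)) ?sum_nat_const ?cF 1?mulnC //.
  by move=> S /Fa[].
have [|S [SU cS Sa]] := egza I v (U :\: cover F).
  rewrite cardsD (setIidPr FU) cc leq_subRL.
    by rewrite (leq_trans _ hU) // leq_add2r leq_mul2l leqnSn orbT.
  by rewrite -cc subset_leq_card.
have Sdisj : [disjoint S & cover F].
  by move: SU; rewrite subsetD => /andP[].
(* Since [a] is positive, [S] is nonempty, so disjointness from the cover keeps it out of [F]. *)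
have SF : S \notin F.
  apply/negP => SF; have : #|S| = 0.
    apply/eqP; rewrite cards_eq0 -subset0; apply/subsetP => x xS.
    move/pred0P: Sdisj => /(_ x) /=; rewrite xS /= => /negbT /bigcupP; case.
    by exists S.
  by move=> S0; rewrite S0 in cS; rewrite -cS in a0.
exists (S |: F); split.
- by rewrite cardsU1 SF cF.
- apply/trivIsetP => S1 S2; rewrite !inE.
  have dF S' : S' \in F -> [disjoint S & S'].
    move=> S'F; apply: disjointWr Sdisj; exact: bigcup_sup.
  case/predU1P => [->|S1F] /predU1P[->|S2F].
  + by rewrite eqxx.
  + by move=> _; exact: dF.
  + by move=> _; rewrite disjoint_sym; exact: dF.
  + exact: (trivIsetP tF).
- rewrite /cover big_setU1 //= subUset FU andbT.
  by apply: subset_trans SU (subsetDl _ _).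
- by move=> S'; rewrite !inE => /predU1P[->|/Fa].
Qed.

(** The [mb] extracted blocks are the terms of a new sequence whose values are the block sums
    divided by [a]. A union of [b] blocks whose quotients add up to 0 modulo [b] is the required
    zero-sum. *)
Lemma egz_mul (a b n ma mb : nat) : (0 < a)%N ->
  egz_prop a n ma -> egz_prop b n mb -> egz_prop (a * b) n (a * mb + ma).
Proof.
move=> a0 egza egzb I v U hU.
have [F [cF tF FU Fa]] := egz_disjoint_family v a0 egza hU.
have [|T [TF cT Tb]] := egzb _ (fun (S : {set I}) j => (\sum_(i in S) v i j) %/ a)%N F.
  by rewrite cF.
have tT := trivIsetS TF tF.
exists (cover T); split.
- apply: subset_trans FU; apply/bigcupsP => S /(subsetP TF) SF.
  exact: (bigcup_sup S).
- move: tT => /eqP <-; rewrite (eq_bigr (fun=> a)) ?sum_nat_const ?cT 1?mulnC //.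
  by move=> S /(subsetP TF)/Fa[].
- move=> j; rewrite big_trivIset //=.
  rewrite (eq_bigr (fun S : {set I} => a * ((\sum_(i in S) v i j) %/ a)))%N.
    by rewrite -big_distrr /= dvdn_mul.
  by move=> S /(subsetP TF)/Fa[_ /(_ j) Sa]; rewrite mulnC divnK.
Qed.

Lemma egz_le (k n m m' : nat) : (m <= m')%N -> egz_prop k n m -> egz_prop k n m'.
Proof. by move=> mm egz I v U /(leq_trans mm)/egz. Qed.

(** * Passage to the constant [EGZ] and to composite moduli *)

Lemma inZp_sum (p : nat) (I : finType) (S : {set I}) (f : I -> nat) :
  inZp (\sum_(i in S) f i)%N = \sum_(i in S) (inZp (f i) : 'I_p.+1).
Proof.
by apply: (big_morph inZp) => [x y|]; apply: val_inj; rewrite /= ?modnDm ?mod0n.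
Qed.

(** The dimension is positive because the trivial group of dimension 0 has exponent 1. *)
Lemma group_exp_Zmod_pow (k n : nat) : (0 < k)%N -> group_exp (Zmod_pow k n.+1) = k.
Proof.
case: k => // k _; apply/eqP; rewrite eqn_leq; apply/andP; split.
  apply/bigmax_leqP => x _; apply: dvdn_leq => //.
  rewrite order_dvdn FinRing.zmodXgE; apply/eqP/rowP => j.
  rewrite mulmxnE mxE Zp_mulrn; apply: val_inj => /=.
  by rewrite modnMl.
pose x : Zmod_pow k.+1 n.+1 := const_mx (inZp 1).
apply: leq_trans (leq_bigmax x); apply: dvdn_leq; first exact: order_gt0.
have /eqP : (x ^+ #[x])%g = 1%g by exact: expg_order.
rewrite FinRing.zmodXgE => /eqP/rowP/(_ ord0).
rewrite mulmxnE !mxE Zp_mulrn => /(congr1 val) /=.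
by rewrite modnMml mul1n => /eqP.
Qed.

Lemma EGZ_le (k n m : nat) : (0 < k)%N -> egz_prop k n.+1 m ->
  (EGZ (Zmod_pow k n.+1) <= m)%N.
Proof.
case: k => // k _ egz; rewrite /EGZ; case: ex_minnP => e _; apply.
apply/forallP => s; apply/existsP; rewrite group_exp_Zmod_pow //.
(* The indices are the positions in [s], so equal entries stay distinct, and [enum S] lists
   positions in increasing order, which spells a subsequence. *)
have [|S [_ cS Sk]] := egz _ (fun (i : 'I_m) j => nat_of_ord (tnth s i 0 j)) setT.
  by rewrite cardsT card_ord.
have sz : size (map (tnth s) (enum S)) == k.+1 by rewrite size_map -cardE cS.
exists (Tuple sz); apply/andP; split.
  rewrite /= -[X in subseq _ X](map_tnth_enum s); apply: map_subseq.
  by rewrite [enum 'I_m]enumT; exact: filter_subseq.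
rewrite /= big_map big_enum /=; apply/eqP/rowP => j; rewrite summxE mxE.
rewrite (eq_bigr (fun i => inZp (tnth s i 0 j))) => [|i _]; last by rewrite valZpK.
rewrite -inZp_sum; apply: val_inj => /=.
by apply/eqP; exact: Sk.
Qed.

(** This case stands apart: the exponent is 1 whatever [k] is, and every one-term sequence has sum
    0. *)
Lemma EGZ_dim0 (k : nat) : (EGZ (Zmod_pow k 0) <= 1)%N.
Proof.
rewrite /EGZ; case: ex_minnP => e _; apply; apply/forallP => s; apply/existsP.
have -> : group_exp (Zmod_pow k 0) = 1%N.
  apply/eqP; rewrite eqn_leq; apply/andP; split.
    apply/bigmax_leqP => x _; rewrite (_ : x = 1%g) ?order1 //.
    by apply/rowP => -[].
  apply: leq_trans (leq_bigmax (1%g : Zmod_pow k 0)); exact: order_gt0.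
exists s; rewrite subseq_refl /=; apply/eqP/rowP => -[] //.
Qed.

(** Induction on [k], splitting off its least prime factor. In [egz_mul] the two thresholds are
    combined linearly, so only the constant grows and the base [B] stays. *)
Lemma egz_exp_bound (R : archiRealFieldType) (B : R) (k : nat) : 1 <= B -> (0 < k)%N ->
  (forall p, prime p -> (p %| k)%N -> exists C : R, forall n m : nat,
     C * B ^+ n <= m%:R -> egz_prop p n m) ->
  exists C : R, forall n m : nat, C * B ^+ n <= m%:R -> egz_prop k n m.
Proof.
move=> B1 k0; have [c] := ubnP k; elim: c k k0 => // c IH k k0 kc egzp.
have Bn n : 1 <= B ^+ n by exact: exprn_ege1.
have [k1|k1] := leqP k 1.
  have -> : k = 1%N by apply/eqP; rewrite eqn_leq k1.
  exists 1 => n m; rewrite mul1r => /(le_trans (Bn n)); rewrite ler1n.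
  exact: egz_one.
have pp := pdiv_prime k1; have pk := pdiv_dvd k; set p := pdiv k in pp pk.
have kE : k = (p * (k %/ p))%N by rewrite mulnC divnK.
have p_gt0 := prime_gt0 pp.
have k'0 : (0 < k %/ p)%N by rewrite divn_gt0 // dvdn_leq.
have [||C' hC'] := IH _ k'0.
- by rewrite -ltnS; apply: leq_trans kc; rewrite ltnS ltn_Pdiv // prime_gt1.
- by move=> p' p'p p'k; apply: egzp => //; rewrite kE dvdn_mull.
have [Cp hCp] := egzp p pp pk.
(* Thresholds are integers; as [B ^+ n] is at least 1, rounding up adds at most 1 to the
   constant. *)
have ceil (C : R) n : exists2 m : nat, C * B ^+ n <= m%:R & m%:R <= (`|C| + 1) * B ^+ n.
  have CB : 0 <= `|C| * B ^+ n by rewrite mulr_ge0 // (le_trans _ (Bn n)).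
  have := truncn_itv CB => /andP[h1 h2].
  exists (Num.truncn (`|C| * B ^+ n)).+1.
    apply: le_trans (ltW h2); rewrite ler_wpM2r ?ler_norm //.
    exact: le_trans (Bn n).
  by rewrite -natr1 mulrDl mul1r lerD.
exists (p%:R * (`|C'| + 1) + (`|Cp| + 1)) => n m hm.
have [m' m'1 m'2] := ceil C' n; have [mp mp1 mp2] := ceil Cp n.
rewrite kE; apply: (@egz_le _ _ (p * m' + mp)); last first.
  by apply: egz_mul => //; [exact: hCp | exact: hC'].
rewrite -(ler_nat R); apply: le_trans hm.
by rewrite natrD natrM mulrDl -mulrA lerD // ler_wpM2l.
Qed.

From mathcomp Require Import all_classical all_reals all_analysis.
Import numFieldNormedType.Exports.
Local Open Scope classical_set_scope.
Local Open Scope ring_scope.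

(** * Estimates for [J_fun] *)

Lemma J_funE (R : realType) (q : nat) (x : R) : x < 1 ->
  J_fun q x = (\sum_(i < q) x ^+ i) * x `^ (- ((q%:R - 1) / 3)).
Proof.
move=> x1; rewrite /J_fun; congr (_ * _).
rewrite -{1}(expr1n R q) subrXX mulrC mulKf ?subr_eq0 ?gt_eqF //.
by apply: eq_bigr => i _; rewrite expr1n mul1r.
Qed.

(** Expand (1 + x + ... + x^d)^n as a sum of x^(deg a) over all exponent vectors a. As x < 1, each
    low vector contributes at least x^(d n / 3), and the other terms are nonnegative. *)
Lemma card_low_exponents_le (R : realType) (d n : nat) (x : R) : 0 < x < 1 ->
  #|low_exponents d n|%:R <= J_fun d.+1 x ^+ n.
Proof.
move=> /andP[x0 x1]; rewrite J_funE // exprMn.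
have dE : (d.+1%:R - 1 : R) = d%:R by rewrite -natr1 addrK.
rewrite dE -[X in _ * X]powR_mulrn ?powR_ge0 // -powRrM.
pose w := x `^ (- (d%:R / 3) * n%:R); rewrite -/w.
have -> : (\sum_(i < d.+1) x ^+ i) ^+ n =
    \sum_(a : {ffun 'I_n -> 'I_d.+1}) x ^+ (\sum_j a j)%N.
  rewrite -[in LHS](card_ord n) -prodr_const bigA_distr_bigA.
  by apply: eq_bigr => a _; rewrite expr_sum.
rewrite mulr_suml -sum1_card natr_sum big_mkcond /=.
apply: ler_sum => a _; case: ifP => [|_]; last first.
  by rewrite mulr_ge0 ?powR_ge0 // exprn_ge0 // ltW.
rewrite inE => low.
rewrite /w -powR_mulrn ?(ltW x0) // -powRD; last by apply/implyP => _; rewrite gt_eqF.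
rewrite -[leLHS](powRr0 x); apply: ger_powR; first by rewrite x0 ltW.
have : (3 * \sum_j a j)%N%:R <= (d * n)%N%:R :> R by rewrite ler_nat.
by rewrite !natrM; lra.
Qed.

Lemma J_fun_le (R : realType) (p q : nat) (x : R) : 0 < x < 1 -> (p <= q)%N ->
  J_fun p x <= J_fun q x.
Proof.
move=> /andP[x0 x1] pq; rewrite !J_funE //.
apply: ler_pM; rewrite ?powR_ge0 //.
- by apply: sumr_ge0 => i _; rewrite exprn_ge0 // ltW.
- rewrite (big_ord_widen _ (fun i => x ^+ i) pq) big_mkcond /=.
  by apply: ler_sum => i _; case: ifP => // _; rewrite exprn_ge0 // ltW.
- apply: ger_powR; first by rewrite x0 ltW.
  have : p%:R <= q%:R :> R by rewrite ler_nat.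
  by move=> ?; lra.
Qed.

Lemma J_fun_ge1 (R : realType) (q : nat) (x : R) : 0 < x < 1 -> (0 < q)%N ->
  1 <= J_fun q x.
Proof.
move=> x01 q0; apply: le_trans (J_fun_le x01 q0).
case/andP: x01 => x0 x1; rewrite J_funE // big_ord1 subrr mul0r oppr0 powRr0.
by rewrite mulr1.
Qed.

(** This absorbs the bound 2 ^ n for the prime 2. By monotonicity it suffices to treat q = 3, where
    x = t ^ 3 turns the claim into 2 t ^ 2 <= 1 + t ^ 3 + t ^ 6. *)
Lemma J_fun_ge2 (R : realType) (q : nat) (x : R) : 0 < x < 1 -> (2 < q)%N ->
  2 <= J_fun q x.
Proof.
move=> x01 q3; apply: le_trans (J_fun_le x01 q3).
case/andP: x01 => x0 x1; rewrite J_funE // !big_ord_recl big_ord0 /=.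
pose t := x `^ 3^-1.
have t0 : 0 < t by exact: powR_gt0.
have t1 : t <= 1 by rewrite -(powRr0 x); apply: ger_powR; [rewrite x0 ltW|lra].
have xE : x = t ^+ 3.
  by rewrite /t -powR_mulrn ?powR_ge0 // -powRrM mulVf ?powRr1 ?(ltW x0) ?pnatr_eq0 //.
set a := x `^ _; have -> : a = (t ^+ 2)^-1.
  rewrite /t -powR_mulrn ?powR_ge0 // -powRrM -powRN; congr (_ `^ _).
  by field.
rewrite ler_pdivlMr ?exprn_gt0 // xE /bump /= expr0 expr1 addr0.
(* With x = t ^ 3, the claim is (1 - t ^ 2) ^ 2 + t ^ 3 (1 - t + t ^ 3) >= 0. *)
have h : 0 <= t ^+ 3 * (1 - t + t ^+ 3).
  apply: mulr_ge0; first exact: exprn_ge0 (ltW t0).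
  by apply: addr_ge0; [rewrite subr_ge0|exact: exprn_ge0 (ltW t0)].
have := sqr_ge0 (1 - t ^+ 2); rewrite -exprM; nra.
Qed.

(** The estimates hold at every point of ]0, 1[, so a minimizer can be fixed and J(q) q treated as a
    single value of [J_fun q]. *)
Lemma J_mul_minimum (R : realType) (q : nat) : (0 < q)%N ->
  exists2 x : R, 0 < x < 1 & J R q * q%:R = J_fun q x.
Proof.
move=> q0; have [[x x01 xE] _] := getPex (@J_fun_minimum R q q0).
exists x; first by move: x01; rewrite /= in_itv.
by rewrite /J /minimum -xE mulrAC mulVf ?mul1r // pnatr_eq0 -lt0n.
Qed.

(** * Prime moduli and the final estimate *)

Lemma egz_prime_bound (R : realType) (p q : nat) (x : R) : 0 < x < 1 -> prime p ->
  (p <= q)%N -> (2 < q)%N ->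
  exists C : R, forall n m : nat, C * J_fun q x ^+ n <= m%:R -> egz_prop p n m.
Proof.
move=> x01 pp pq q3.
have J0 : 0 <= J_fun q x := le_trans (ler0n R 2) (J_fun_ge2 x01 q3).
have J1 n : 1 <= J_fun q x ^+ n.
  by apply: exprn_ege1; apply: J_fun_ge1 => //; apply: leq_trans q3.
case: (even_prime pp) => [->|oddp].
  (* The constant 2 rather than 1 makes the inequality 2 ^ n < m strict. *)
  exists 2 => n m hm; apply: egz_two; rewrite -(ltr_nat R) natrX.
  apply: lt_le_trans hm.
  have : 2 ^+ n <= J_fun q x ^+ n by rewrite lerXn2r ?nnegrE // J_fun_ge2.
  by have := J1 n; lra.
(* The product is the factor in [egz_odd_prime]; the added 1 makes the inequality strict. *)
exists (p * (p.*2 * 3) + 1)%:R => n m hm.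
apply: egz_odd_prime => //; rewrite -(ltr_nat R); apply: lt_le_trans hm.
rewrite natrD mulrDl mul1r !mulnA natrM -[ltLHS]addr0.
apply: ler_ltD; last exact: lt_le_trans (J1 n).
rewrite ler_wpM2l //; apply: le_trans (card_low_exponents_le _ _ x01) _.
rewrite prednK ?prime_gt0 // lerXn2r ?nnegrE // ?J_fun_le //.
by apply: le_trans (J_fun_ge1 x01 (prime_gt0 pp)).
Qed.

Theorem corollary1 (R : realType) (k q : nat)
    (hk : (0 < k)%N) (hk2 : k <> 2%N)
    (hq : largest_prime_power_divisor k q) :
  exists2 e : nat -> R, e @ \oo --> (0 : R) &
    forall n : nat,
      (EGZ (Zmod_pow k n))%:R <= (J R q * q%:R + e n) ^+ n.
Proof.
have [[p0 [e0 [p0p qE]]] qk qmax] := hq.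
have q0 : (0 < q)%N by rewrite qE expn_gt0 prime_gt0.
have pq p : prime p -> (p %| k)%N -> (p <= q)%N.
  by move=> pp; apply: qmax; exists p, 1%N; rewrite expn1.
(* Only p = 2 needs care: as k is not 2, k / 2 has a prime factor, so either 4 or an odd prime
   divides k. For k = 1 there is no such p. *)
have q3 p : prime p -> (p %| k)%N -> (2 < q)%N.
  move=> pp pk; case: (even_prime pp) => [p2|oddp]; last first.
    by apply: leq_trans (pq p pp pk); apply: odd_prime_gt2.
  rewrite p2 in pk; have kE := divnK pk.
  have [k21|k21] := leqP (k %/ 2) 1.
    have k2_gt0 : (0 < k %/ 2)%N by rewrite divn_gt0 // dvdn_leq.
    by case: hk2; rewrite -kE (_ : (k %/ 2 = 1)%N) //; apply/eqP; rewrite eqn_leq k21.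
  have r_prime := pdiv_prime k21; have rk := pdiv_dvd (k %/ 2).
  case: (even_prime r_prime) => [r2|oddr].
    suff : (4 <= q)%N by exact: leq_trans.
    apply: qmax; first by exists 2%N, 2%N.
    by rewrite r2 in rk; rewrite -kE; exact: (dvdn_mul rk (dvdnn 2)).
  apply: leq_trans (pq (pdiv (k %/ 2)) r_prime _); first exact: odd_prime_gt2.
  by apply: (dvdn_trans rk); rewrite -{2}kE dvdn_mulr.
have [x x01 JE] := J_mul_minimum R q0; rewrite JE; set B := J_fun q x.
have B1 : 1 <= B by exact: J_fun_ge1.
have [C hC] : exists C : R, forall n m : nat, C * B ^+ n <= m%:R -> egz_prop k n m.
  apply: egz_exp_bound => // p pp pk; apply: egz_prime_bound => //; first exact: pq.
  exact: (q3 p).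
clearbody B.
have [D D0 hD] : exists2 D : R, 0 < D & forall n,
    (EGZ (Zmod_pow k n.+1))%:R <= D * B ^+ n.+1.
  (* If the bound failed, the predecessor of the [EGZ] value would still exceed C B^n, against
     minimality; the added 1 pays for the predecessor. *)
  exists (`|C| + 1) => [|n]; first by rewrite ltr_wpDl.
  have Bn : 1 <= B ^+ n.+1 by exact: exprn_ege1.
  rewrite leNgt; apply/negP => lt_EGZ.
  have E0 : (0 < EGZ (Zmod_pow k n.+1))%N.
    rewrite -(ltr_nat R); apply: le_lt_trans lt_EGZ.
    by rewrite mulr_ge0 ?addr_ge0 // (le_trans _ Bn).
  have : egz_prop k n.+1 (EGZ (Zmod_pow k n.+1)).-1.
    apply: hC; rewrite -(lerD2r 1) natr1 prednK //; apply: ltW.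
    apply: le_lt_trans lt_EGZ; rewrite mulrDl mul1r lerD //.
    by rewrite ler_wpM2r ?ler_norm // (le_trans _ Bn).
  by move/(EGZ_le hk); rewrite -ltnS prednK // ltnn.
(* With this choice B + e n = B D^(1/n), whose n-th power is D B^n, and D^(1/n) tends to 1. At n = 0
   the inverse is 0 by convention and e 0 = 0. *)
exists (fun n => B * (expR (ln D * n%:R^-1) - 1)).
  have -> : (0 : R) = B * (expR (ln D * 0) - 1) by rewrite mulr0 expR0 subrr mulr0.
  have inv_cvg : (fun n => n%:R^-1 : R) @ \oo --> (0 : R).
    by rewrite -cvg_shiftS; exact: cvg_harmonic.
  have ln_cvg : (fun n => ln D * n%:R^-1) @ \oo --> ln D * 0.
    exact: (cvgM (cvg_cst (ln D)) inv_cvg).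
  have exp_cvg : (fun n => expR (ln D * n%:R^-1)) @ \oo --> expR (ln D * 0).
    by apply: continuous_cvg ln_cvg; exact: continuous_expR.
  by apply: cvgM; [exact: cvg_cst | apply: cvgB; [exact: exp_cvg | exact: cvg_cst]].
case=> [|n]; first by rewrite expr0 -[leRHS]/(1%:R) ler_nat EGZ_dim0.
apply: le_trans (hD n) _; rewrite mulrBr mulr1 addrC subrK exprMn mulrC.
rewrite ler_wpM2l ?exprn_ge0 ?(le_trans _ B1) //.
by rewrite -expRM_natr -mulrA mulVf ?pnatr_eq0 // mulr1 lnK.
Qed.
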